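(* Let $H$ be a cocommutative Hopf algebra over a field $\mathbb{K}$. Let $P$ be a right $H$-comodule algebra that is piecewise principal with respect to a family $\{\pi_i:P\to P_i\}_{i\in\{0,\ldots,n\}}$ of surjective $H$-comodule algebra morphisms, and let $\{\ell_i:H\to P_i\otimes P_i\}_{i\in\{0,\ldots,n\}}$ be a family of strong connections on the $P_i$'s, written $\ell_i(h)=\ell_i(h)^{\langle 1\rangle}\otimes \ell_i(h)^{\langle 2\rangle}$. For each $i\in\{0,\ldots,n\}$, let $V_i$ be an $H$-subcomodule of $P_i$ such that $\ell_i(H)\subseteq V_i\otimes V_i$, and let $\alpha_i:V_i\to P$ be a unital, right $H$-colinear splitting of $\pi_i$, i.e. $\pi_i\circ\alpha_i=\mathrm{id}_{V_i}$. For $i\in\{0,\ldots,n\}$ and $h\in H$ put $$\theta_i(h):=\epsilon(h)-\alpha_i\big(\ell_i(h)^{\langle 1\rangle}\big)\,\alpha_i\big(\ell_i(h)^{\langle 2\rangle}\big),$$ $$T_i(h):=\theta_i(h_{(1)})\,\theta_{i+1}(h_{(2)})\cdots\theta_n(h_{(n-i+1)}),\qquad T_{n+1}(h):=\epsilon(h).$$ Then the linear map $\ell:H\to P\otimes P$ defined for all $h\in H$ by $$\ell(h)=\sum_{i=0}^n\alpha_i\big(\ell_i(h_{(1)})^{\langle 1\rangle}\big)\otimes\alpha_i\big(\ell_i(h_{(1)})^{\langle 2\rangle}\big)\,T_{i+1}(h_{(2)})$$ is a strong connection on $P$.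
   Context: All vector spaces, algebras and tensor products are over a fixed field $\mathbb{K}$ (algebraic tensor products); algebras are unital and algebra homomorphisms are unital. $\Delta,\epsilon,S$ are the comultiplication, counit and antipode of $H$. Scalars such as $\epsilon(h)$ are identified with $\epsilon(h)1$ in the relevant algebra. Sweedler notation (summation suppressed): $\Delta(h)=h_{(1)}\otimes h_{(2)}$, and for a right $H$-comodule (algebra) $P$ with coaction $\Delta_P:P\to P\otimes H$, $\Delta_P(p)=p_{(0)}\otimes p_{(1)}$. The coaction-invariant subalgebra is $P^{\mathrm{co}H}:=\{p\in P \mid \Delta_P(p)=p\otimes 1_H\}$. Strong connection: let $H$ be a Hopf algebra with bijective antipode (automatic when $H$ is cocommutative) and $P$ a right $H$-comodule algebra. A strong connection on $P$ is a linear map $\ell:H\to P\otimes P$, $\ell(h)=:\ell(h)^{\langle1\rangle}\otimes\ell(h)^{\langle2\rangle}$ (summation suppressed), such that for all $h\in H$: (a) $\ell(1_H)=1_P\otimes 1_P$; (b) $\ell(h)^{\langle1\rangle}\ell(h)^{\langle2\rangle}=\epsilon(h)$; (c) $\ell(h_{(1)})^{\langle1\rangle}\otimes\ell(h_{(1)})^{\langle2\rangle}\otimes h_{(2)}=\ell(h)^{\langle1\rangle}\otimes\ell(h)^{\langle2\rangle}{}_{(0)}\otimes\ell(h)^{\langle2\rangle}{}_{(1)}$; (d) $S(h_{(1)})\otimes\ell(h_{(2)})^{\langle1\rangle}\otimes\ell(h_{(2)})^{\langle2\rangle}=\ell(h)^{\langle1\rangle}{}_{(1)}\otimes\ell(h)^{\langle1\rangle}{}_{(0)}\otimes\ell(h)^{\langle2\rangle}$.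 $P$ is called a principal $H$-comodule algebra if a strong connection on $P$ exists. Covering: a finite family of surjective algebra homomorphisms $\{\pi_i:P\to P_i\}_i$ is a covering if $\bigcap_i\ker\pi_i=\{0\}$ and the ideals $\ker\pi_i$ generate a distributive lattice of ideals with respect to $+$ and $\cap$. Piecewise principal: an $H$-comodule algebra $P$ is piecewise principal with respect to a finite family $\{\pi_i:P\to P_i\}_{i}$ of surjective $H$-comodule algebra morphisms if (1) the restrictions $\pi_i|_{P^{\mathrm{co}H}}:P^{\mathrm{co}H}\to P_i^{\mathrm{co}H}$ form a covering, and (2) every $P_i$ is a principal $H$-comodule algebra. (Since $\ell_i(1)=1\otimes 1\in V_i\otimes V_i$, each $V_i$ contains $1$, so unitality $\alpha_i(1)=1$ makes sense.) *)

(* Defs.v *)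
From HB Require Import structures.
From mathcomp Require Import all_boot all_algebra.
From mathcomp Require Import boolp classical_sets.

Set Implicit Arguments.
Unset Strict Implicit.
Unset Printing Implicit Defensive.

Import GRing.Theory.
Local Open Scope classical_set_scope.
Local Open Scope ring_scope.
Local Open Scope quotient_scope.

Section Tensor.
Context (K : fieldType) (V W : lmodType K).

(* V ⊗ W is the quotient of the formal finite sums of pairs, encoded as lists,
   by bilinearity. A coefficient is absorbed into the first component of a pair,
   so that no separate scalars are needed, and TR0 makes the monoid of classes
   a group. tlift and tliftE give the universal property. *)
Inductive tensor_rel : seq (V * W) -> seq (V * W) -> Prop :=
| TRrefl s : tensor_rel s s
| TRsym s t : tensor_rel s t -> tensor_rel t s
| TRtrans s t u : tensor_rel s t -> tensor_rel t u -> tensor_rel s u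
| TRcat s s' t t' :
    tensor_rel s s' -> tensor_rel t t' -> tensor_rel (s ++ t) (s' ++ t')
| TRcatC s t : tensor_rel (s ++ t) (t ++ s)
| TRDl v v' w : tensor_rel [:: (v + v', w)] [:: (v, w); (v', w)]
| TRDr v w w' : tensor_rel [:: (v, w + w')] [:: (v, w); (v, w')]
| TRZ a v w : tensor_rel [:: (a *: v, w)] [:: (v, a *: w)]
| TR0 w : tensor_rel [:: (0, w)] [::].

Definition tensor_relb s t : bool := `[< tensor_rel s t >].

Lemma tensor_relb_refl : reflexive tensor_relb.
Proof. by move=> s; apply/asboolP; exact: TRrefl. Qed.

Lemma tensor_relb_sym : symmetric tensor_relb.
Proof.
move=> s t; apply/idP/idP => /asboolP h; apply/asboolP; exact: TRsym.
Qed.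

Lemma tensor_relb_trans : transitive tensor_relb.
Proof.
move=> s t u /asboolP h /asboolP k; apply/asboolP; exact: TRtrans h k.
Qed.

Definition tensor_equiv :=
  EquivRel tensor_relb tensor_relb_refl tensor_relb_sym tensor_relb_trans.

Definition tensor : Type := {eq_quot tensor_equiv}.
HB.instance Definition _ : EqQuotient _ tensor_equiv tensor :=
  EqQuotient.on tensor.
HB.instance Definition _ := Choice.on tensor.

Definition tpi (s : seq (V * W)) : tensor := \pi_tensor s.
Definition trepr (t : tensor) : seq (V * W) := repr t.

Lemma treprK : cancel trepr tpi.
Proof. exact: reprK. Qed.

Lemma tpiP s t : tpi s = tpi t <-> tensor_rel s t.
Proof. by split => [/eqmodP/asboolP //|h]; exact/eqmodP/asboolP. Qed.

Lemma tensor_rel_swap x y s t :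
  tensor_rel ([:: x; y] ++ (s ++ t)) (x :: s ++ y :: t).
Proof.
suff h : tensor_rel ([:: y] ++ (s ++ t)) (s ++ ([:: y] ++ t)).
  exact: (TRcat (TRrefl [:: x]) h).
by rewrite !catA; apply: TRcat; [exact: TRcatC|exact: TRrefl].
Qed.

Definition scale_seq (a : K) (s : seq (V * W)) := [seq (a *: x.1, x.2) | x <- s].

Lemma scale_seq_rel a s t :
  tensor_rel s t -> tensor_rel (scale_seq a s) (scale_seq a t).
Proof.
elim=> {s t} /=.
- by move=> *; exact: TRrefl.
- by move=> *; exact: TRsym.
- by move=> s t u _ h _ k; exact: TRtrans h k.
- by move=> *; rewrite /scale_seq !map_cat; exact: TRcat.
- by move=> *; rewrite /scale_seq !map_cat; exact: TRcatC.
- by move=> v v' w; rewrite scalerDr; exact: TRDl.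
- by move=> v w w'; exact: TRDr.
- by move=> b v w; rewrite scalerA mulrC -scalerA; exact: TRZ.
- by move=> w; rewrite scaler0; exact: TR0.
Qed.

Definition tadd (x y : tensor) : tensor := tpi (trepr x ++ trepr y).
Definition tzero : tensor := tpi [::].
Definition tscale (a : K) (x : tensor) : tensor := tpi (scale_seq a (trepr x)).
Definition topp (x : tensor) : tensor := tscale (-1) x.

Lemma repr_rel s : tensor_rel (trepr (tpi s)) s.
Proof. by apply/tpiP; rewrite treprK. Qed.

Lemma taddE s t : tadd (tpi s) (tpi t) = tpi (s ++ t).
Proof. by apply/tpiP; apply: TRcat; exact: repr_rel. Qed.

Lemma tscaleE a s : tscale a (tpi s) = tpi (scale_seq a s).
Proof. by apply/tpiP; apply: scale_seq_rel; exact: repr_rel. Qed.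

Lemma tpi_ind (Q : tensor -> Prop) : (forall s, Q (tpi s)) -> forall t, Q t.
Proof. by move=> h t; rewrite -[t]treprK; exact: h. Qed.

Lemma taddA : associative tadd.
Proof.
by elim/tpi_ind=> x; elim/tpi_ind=> y; elim/tpi_ind=> z; rewrite !taddE catA.
Qed.

Lemma taddC : commutative tadd.
Proof.
elim/tpi_ind=> x; elim/tpi_ind=> y; rewrite !taddE; apply/tpiP; exact: TRcatC.
Qed.

Lemma tadd0 : left_id tzero tadd.
Proof. by elim/tpi_ind=> x; rewrite taddE. Qed.

Lemma taddN : left_inverse tzero topp tadd.
Proof.
elim/tpi_ind=> x; rewrite /topp tscaleE taddE; apply/tpiP.
elim: x => [|[v w] s IH] /=; first exact: TRrefl.
apply: (@TRtrans _ ([:: (-1 *: v, w); (v, w)] ++ (scale_seq (-1) s ++ s))).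
  apply: TRsym; exact: tensor_rel_swap.
rewrite -[[::] in X in tensor_rel _ X]/([::] ++ [::] : seq (V * W)).
apply: TRcat => //; apply: TRtrans (TR0 w).
by rewrite -(addNr v) -scaleN1r; apply: TRsym; exact: TRDl.
Qed.

HB.instance Definition _ :=
  GRing.isZmodule.Build tensor taddA taddC tadd0 taddN.

Lemma tscaleA a b x : tscale a (tscale b x) = tscale (a * b) x.
Proof.
elim/tpi_ind: x => s; rewrite !tscaleE /scale_seq -map_comp.
by congr tpi; apply: eq_map => x /=; rewrite scalerA.
Qed.

Lemma tscale1 : left_id 1 tscale.
Proof.
elim/tpi_ind=> s; rewrite tscaleE; congr tpi.
by rewrite -[RHS]map_id; apply: eq_map => -[v w] /=; rewrite scale1r.
Qed.

Lemma tscaleDr : right_distributive tscale +%R.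
Proof.
move=> a; elim/tpi_ind=> s; elim/tpi_ind=> t; rewrite -![_ + _]/(tadd _ _).
by rewrite taddE !tscaleE taddE /scale_seq map_cat.
Qed.

Lemma tscaleDl x : {morph tscale^~ x : a b / a + b}.
Proof.
move=> a b; elim/tpi_ind: x => s; rewrite -![_ + _ in RHS]/(tadd _ _).
rewrite !tscaleE taddE; apply/tpiP; elim: s => [|[v w] s IH] /=.
  exact: TRrefl.
rewrite -cat1s; apply: (@TRtrans _ ([:: (a *: v, w); (b *: v, w)] ++
   (scale_seq a s ++ scale_seq b s))).
  by apply: TRcat => //; rewrite scalerDl; exact: TRDl.
exact: tensor_rel_swap.
Qed.

HB.instance Definition _ := GRing.Zmodule_isLmodule.Build K tensor
  tscaleA tscale1 tscaleDr tscaleDl.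

Definition tens (v : V) (w : W) : tensor := tpi [:: (v, w)].

Lemma tensDl v v' w : tens (v + v') w = tens v w + tens v' w.
Proof. by rewrite -[_ + _ in RHS]/(tadd _ _) taddE; apply/tpiP; exact: TRDl. Qed.

Lemma tensDr v w w' : tens v (w + w') = tens v w + tens v w'.
Proof. by rewrite -[_ + _ in RHS]/(tadd _ _) taddE; apply/tpiP; exact: TRDr. Qed.

Lemma tensZl a v w : tens (a *: v) w = a *: tens v w.
Proof. by rewrite -[_ *: _ in RHS]/(tscale _ _) tscaleE. Qed.

Lemma tensZr a v w : tens v (a *: w) = a *: tens v w.
Proof. by rewrite -tensZl; apply/tpiP/TRsym; exact: TRZ. Qed.

Lemma tens_sum (s : seq (V * W)) : tpi s = \sum_(x <- s) tens x.1 x.2.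
Proof.
elim: s => [|[v w] s IH]; first by rewrite big_nil.
by rewrite big_cons -IH -[_ + _]/(tadd _ _) taddE.
Qed.

Lemma tensor_ind (Q : tensor -> Prop) :
  (forall v w, Q (tens v w)) -> (forall x y, Q x -> Q y -> Q (x + y)) ->
  forall t, Q t.
Proof.
move=> Qt QD; elim/tpi_ind=> s; rewrite tens_sum.
elim: s => [|[v w] s IH]; last by rewrite big_cons; apply: QD.
rewrite big_nil; suff -> : 0 = tens 0 0 by [].
by have := tensZl 0 0 0; rewrite !scale0r => ->.
Qed.

Section Lift.
Context (Z : lmodType K).

Definition bilinear_fun (f : V -> W -> Z) : Prop :=
  (forall a v v' w, f (a *: v + v') w = a *: f v w + f v' w) /\
  (forall a v w w', f v (a *: w + w') = a *: f v w + f v w').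

Definition tlift (f : V -> W -> Z) (bf : bilinear_fun f) (t : tensor) : Z :=
  \sum_(x <- trepr t) f x.1 x.2.

Context (f : V -> W -> Z) (bf : bilinear_fun f).

Lemma tlift_rel s t : tensor_rel s t ->
  \sum_(x <- s) f x.1 x.2 = \sum_(x <- t) f x.1 x.2.
Proof.
case: bf => fl fr.
have f0 w : f 0 w = 0.
  have := fl 0 0 0 w; rewrite scale0r add0r scale0r add0r.
  by have := fl (-1) 0 0 w; rewrite scaler0 addr0 scaleN1r addNr.
have fr0 v : f v 0 = 0.
  by have := fr (-1) v 0 0; rewrite scaler0 addr0 scaleN1r addNr.
elim=> {s t} //=.
- by move=> s t u _ -> _ ->.
- by move=> s s' t t' _ h _ k; rewrite !big_cat /= h k.
- by move=> s t; rewrite !big_cat /= addrC.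
- move=> v v' w; rewrite !big_cons !big_nil /= !addr0.
  by have := fl 1 v v' w; rewrite !scale1r.
- move=> v w w'; rewrite !big_cons !big_nil /= !addr0.
  by have := fr 1 v w w'; rewrite !scale1r.
- move=> a v w; rewrite !big_cons !big_nil /= !addr0.
  have := fl a v 0 w; have := fr a v w 0.
  by rewrite !addr0 f0 fr0 !addr0 => -> ->.
- by move=> w; rewrite big_cons !big_nil /= f0 addr0.
Qed.

Lemma tlift_pi s : tlift bf (tpi s) = \sum_(x <- s) f x.1 x.2.
Proof. by apply: tlift_rel; exact: repr_rel. Qed.

Lemma tliftE v w : tlift bf (tens v w) = f v w.
Proof. by rewrite tlift_pi big_cons big_nil addr0. Qed.

Lemma tlift_linear : linear (tlift bf).
Proof.
move=> a; elim/tpi_ind=> s; elim/tpi_ind=> t.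
rewrite -[_ + _ in LHS]/(tadd _ _) -[_ *: _ in LHS]/(tscale _ _).
rewrite tscaleE taddE !tlift_pi big_cat big_map /= scaler_sumr.
congr (_ + _); apply: eq_bigr => x _ /=.
case: bf => fl _; have f0 : f 0 x.2 = 0.
  by have := fl (-1) 0 0 x.2; rewrite scaler0 addr0 scaleN1r addNr.
by have := fl a x.1 0 x.2; rewrite !addr0 f0 addr0.
Qed.

HB.instance Definition _ :=
  GRing.isLinear.Build K tensor Z *:%R (tlift bf) tlift_linear.

End Lift.

Lemma tensor_lin_eq (Z : lmodType K) (f g : {linear tensor -> Z}) :
  (forall v w, f (tens v w) = g (tens v w)) -> f =1 g.
Proof.
move=> h; elim/tensor_ind=> [v w|x y hx hy]; first exact: h.
by rewrite !linearD hx hy.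
Qed.

End Tensor.

Notation "V ⊗ W" := (tensor V W) (at level 40, left associativity).
Notation "v ⊗ₜ w" := (tens v w) (at level 40, left associativity).

Section TensorMaps.
Context (K : fieldType).
Implicit Types U V W X Y Z : lmodType K.

Lemma tmap_bilinear V W X Y (f : {linear V -> X}) (g : {linear W -> Y}) :
  bilinear_fun (fun v w => f v ⊗ₜ g w).
Proof.
split=> a *; first by rewrite linearP tensDl tensZl.
by rewrite linearP tensDr tensZr.
Qed.

Definition tmap V W X Y (f : {linear V -> X}) (g : {linear W -> Y}) :
  {linear V ⊗ W -> X ⊗ Y} := tlift (tmap_bilinear f g).

Lemma tmapE V W X Y (f : {linear V -> X}) (g : {linear W -> Y}) v w :
  tmap f g (v ⊗ₜ w) = f v ⊗ₜ g w.
Proof. exact: tliftE. Qed.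

Lemma tswap_bilinear V W : bilinear_fun (fun (v : V) (w : W) => w ⊗ₜ v).
Proof.
by split=> a *; [rewrite tensDr tensZr|rewrite tensDl tensZl].
Qed.

Definition tswap V W : {linear V ⊗ W -> W ⊗ V} := tlift (@tswap_bilinear V W).

Lemma tswapE V W (v : V) (w : W) : tswap V W (v ⊗ₜ w) = w ⊗ₜ v.
Proof. exact: tliftE. Qed.

Lemma tassoc_bilinear1 U V W (w : W) :
  bilinear_fun (fun (u : U) (v : V) => u ⊗ₜ (v ⊗ₜ w)).
Proof.
by split=> a *; [rewrite tensDl tensZl|rewrite !(tensDl, tensZl, tensDr, tensZr)].
Qed.

Lemma tassoc_bilinear U V W :
  bilinear_fun (fun (t : U ⊗ V) (w : W) => tlift (tassoc_bilinear1 U V w) t).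
Proof.
split=> [a t t' w|a t w w']; first by rewrite linearP.
elim/tensor_ind: t => [u v|x y hx hy].
  by rewrite !tliftE !(tensDr, tensZr).
by rewrite !linearD /= hx hy addrACA.
Qed.

Definition tassoc U V W : {linear U ⊗ V ⊗ W -> U ⊗ (V ⊗ W)} :=
  tlift (@tassoc_bilinear U V W).

Lemma tassocE U V W (u : U) (v : V) (w : W) :
  tassoc U V W (u ⊗ₜ v ⊗ₜ w) = u ⊗ₜ (v ⊗ₜ w).
Proof. by rewrite /tassoc /= !tliftE. Qed.

End TensorMaps.

Section TensorInjective.
Context (K : fieldType).
Implicit Types V W X Y : lmodType K.

Lemma linear_retract V W (f : {linear V -> W}) :
  injective f -> exists r : {linear W -> V}, cancel f r.
Proof.
move=> finj.
have f_eq0 v : f v = 0 -> v = 0 by rewrite -(linear0 f) => /finj.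
pose P (C : set W) := (forall a x y, C x -> C y -> C (a *: x + y)) /\
  (forall v, C (f v) -> f v = 0).
have [|A [[Alin Af] Amax]] := @Zorn_bigcup W P.
  move=> F FP Ftot; split.
    move=> a x y [X FX Xx] [Y FY Yy].
    have [XY|YX] := Ftot _ _ FX FY.
      by exists Y => //; apply: (FP _ FY).1 => //; exact: XY.
    by exists X => //; apply: (FP _ FX).1 => //; exact: YX.
  by move=> v [X FX Xv]; exact: (FP _ FX).2.
have A0 : A 0.
  apply: contrapT => nA0.
  have nA x : ~ A x.
    move=> Ax; apply: nA0; have := Alin (-1) x x Ax Ax.
    by rewrite scaleN1r addNr.
  refine (Amax [set 0] _ _); last first.
    by split=> [a x y -> ->|v ->] //=; rewrite scaler0 addr0.
  split; first by move=> x /nA.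
  by move=> /(_ 0 erefl).
have AZ a x : A x -> A (a *: x) by move=> Ax; rewrite -[_ *: _]addr0; exact: Alin.
have AD x y : A x -> A y -> A (x + y).
  by move=> Ax Ay; rewrite -[x]scale1r; exact: Alin.
have dec w : exists v, A (w - f v).
  apply: contrapT => nw.
  have nA v : ~ A (w - f v) by move=> h; apply: nw; exists v.
  refine (Amax [set x | exists a c, A c /\ x = c + a *: w] _ _).
    split; first by move=> x Ax; exists 0, x; rewrite scale0r addr0.
    move=> BA; apply: (nA 0); rewrite linear0 subr0; apply: BA.
    by exists 1, 0; rewrite scale1r add0r.
  split.
    move=> a _ _ [b [c [Ac ->]]] [b' [c' [Ac' ->]]].
    exists (a * b + b'), (a *: c + c'); split; first exact: Alin.
    by rewrite scalerDr scalerA addrACA -scalerDl.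
  move=> v [a [c [Ac fv]]]; have [a0|a0] := eqVneq a 0.
    by apply: Af; rewrite fv a0 scale0r addr0.
  exfalso; apply: (nA (a^-1 *: v)).
  have -> : w - f (a^-1 *: v) = - a^-1 *: c.
    rewrite linearZ /= fv scalerDr scalerA mulVf // scale1r scaleNr.
    by rewrite opprD addrCA subrr addr0.
  exact: AZ.
have uniq w v v' : A (w - f v) -> A (w - f v') -> v = v'.
  move=> h h'; apply/eqP; rewrite -subr_eq0; apply/eqP/f_eq0/Af.
  rewrite linearB; have -> : f v - f v' = (-1) *: (w - f v) + (w - f v').
    by rewrite scaleN1r opprB addrA subrK.
  exact: Alin.
pose r w := sval (cid (dec w)).
have rP w : A (w - f (r w)) := svalP (cid (dec w)).
have rlin : linear r.
  move=> a x y; apply: uniq (rP _) _.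
  have -> : a *: x + y - f (a *: r x + r y) =
      a *: (x - f (r x)) + (y - f (r y)).
    by rewrite linearP scalerBr opprD addrACA.
  exact: Alin.
pose rL := HB.pack_for {linear W -> V} r (GRing.isLinear.Build K W V *:%R r rlin).
exists rL => v; apply: (uniq (f v)); first exact: rP.
by rewrite subrr.
Qed.

Lemma tmap_inj V W X Y (f : {linear V -> X}) (g : {linear W -> Y}) :
  injective f -> injective g -> injective (tmap f g).
Proof.
move=> /linear_retract[r fK] /linear_retract[s gK].
apply: (can_inj (g := tmap r s)) => t.
elim/tensor_ind: t => [v w|x y hx hy]; first by rewrite !tmapE fK gK.
by rewrite !linearD hx hy.
Qed.

Lemma functional_neq0 V (v : V) : v != 0 ->
  exists phi : {linear V -> K^o}, phi v = 1.
Proof.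
move=> v0.
pose cf (a : K^o) : V := a *: v.
have clin : linear cf.
  by move=> a x y; rewrite /cf scalerDl scalerA.
pose c := HB.pack_for {linear K^o -> V} cf
  (GRing.isLinear.Build K K^o V *:%R cf clin).
have /linear_retract[r cK] : injective c.
  by move=> x y /eqP; rewrite /= /cf -subr_eq0 -scalerBl scaler_eq0 (negPf v0) orbF
     subr_eq0 => /eqP.
by exists r; have := cK 1; rewrite /= /cf scale1r.
Qed.

Lemma tens_neq0 V W (v : V) (w : W) : v != 0 -> w != 0 -> v ⊗ₜ w != 0.
Proof.
move=> /functional_neq0[phi phiv] /functional_neq0[psi psiw].
have bf : bilinear_fun (fun (x : V) (y : W) => (phi x * psi y : K^o)).
  split=> a x y z; rewrite linearP; first by rewrite mulrDl -scalerAl.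
  by rewrite mulrDr -scalerAr.
apply/eqP => h; have := tliftE bf v w.
by rewrite h linear0 phiv psiw mulr1 => /esym/eqP; rewrite oner_eq0.
Qed.

End TensorInjective.

Section TensorAlgebra.
Context (K : fieldType).

Lemma tmul_bilinear (A : algType K) : bilinear_fun (fun x y : A => x * y).
Proof.
split=> a *; first by rewrite mulrDl scalerAl.
by rewrite mulrDr scalerAr.
Qed.

Definition tmul (A : algType K) : {linear A ⊗ A -> A} :=
  tlift (@tmul_bilinear A).

Lemma tmulE (A : algType K) (x y : A) : tmul A (x ⊗ₜ y) = x * y.
Proof. exact: tliftE. Qed.

Context (A B : algType K).

Lemma talg_bilinear1 (a : A) (b : B) :
  bilinear_fun (fun (x : A) (y : B) => (a * x) ⊗ₜ (b * y)).
Proof.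
split=> c *; first by rewrite mulrDr -scalerAr tensDl tensZl.
by rewrite mulrDr -scalerAr tensDr tensZr.
Qed.

Lemma talg_bilinear (t : A ⊗ B) :
  bilinear_fun (fun (a : A) (b : B) => tlift (talg_bilinear1 a b) t).
Proof.
split=> c; elim/tensor_ind: t => [x y|t t' ht ht'] *.
- by rewrite !tliftE mulrDl -scalerAl tensDl tensZl.
- by rewrite !linearD /= ht ht' addrACA.
- by rewrite !tliftE mulrDl -scalerAl tensDr tensZr.
- by rewrite !linearD /= ht ht' addrACA.
Qed.

Definition talg_mul (s t : A ⊗ B) : A ⊗ B := tlift (talg_bilinear t) s.
Definition talg_one : A ⊗ B := 1 ⊗ₜ 1.

Lemma talg_mulE a b x y : talg_mul (a ⊗ₜ b) (x ⊗ₜ y) = (a * x) ⊗ₜ (b * y).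
Proof. by rewrite /talg_mul !tliftE. Qed.

Lemma talg_mulDl : left_distributive talg_mul +%R.
Proof. by move=> x y z; rewrite /talg_mul linearD. Qed.

Lemma talg_mulDr : right_distributive talg_mul +%R.
Proof.
move=> x y z; elim/tensor_ind: x => [a b|s t hs ht].
  by rewrite /talg_mul !tliftE linearD.
by rewrite !talg_mulDl hs ht addrACA.
Qed.

Lemma talg_mulA : associative talg_mul.
Proof.
move=> x y z; elim/tensor_ind: x => [a b|s t hs ht]; last first.
  by rewrite !talg_mulDl hs ht.
elim/tensor_ind: y => [a' b'|s t hs ht]; last first.
  by rewrite !(talg_mulDl, talg_mulDr) hs ht.
elim/tensor_ind: z => [a'' b''|s t hs ht]; last first.
  by rewrite !talg_mulDr hs ht.
by rewrite !talg_mulE !mulrA.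
Qed.

Lemma talg_mul1 : left_id talg_one talg_mul.
Proof.
elim/tensor_ind=> [a b|s t hs ht]; first by rewrite talg_mulE !mul1r.
by rewrite talg_mulDr hs ht.
Qed.

Lemma talg_1mul : right_id talg_one talg_mul.
Proof.
elim/tensor_ind=> [a b|s t hs ht]; first by rewrite talg_mulE !mulr1.
by rewrite talg_mulDl hs ht.
Qed.

Lemma talg_one_neq0 : talg_one != 0.
Proof. by apply: tens_neq0; exact: oner_neq0. Qed.

(* The product is (a ⊗ₜ b) * (x ⊗ₜ y) = (a * x) ⊗ₜ (b * y), see tens_mul. *)
HB.instance Definition _ := GRing.Zmodule_isNzRing.Build (A ⊗ B)
  talg_mulA talg_mul1 talg_1mul talg_mulDl talg_mulDr talg_one_neq0.

Lemma tens_mul (a x : A) (b y : B) : (a ⊗ₜ b) * (x ⊗ₜ y) = (a * x) ⊗ₜ (b * y).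
Proof. exact: talg_mulE. Qed.

Lemma tens_one : 1 = 1 ⊗ₜ 1 :> A ⊗ B.
Proof. by []. Qed.

Lemma talg_scaleAl (c : K) (x y : A ⊗ B) : c *: (x * y) = (c *: x) * y.
Proof. by rewrite -![_ * y]/(talg_mul _ _) /talg_mul linearZ. Qed.

HB.instance Definition _ := GRing.Lmodule_isLalgebra.Build K (A ⊗ B) talg_scaleAl.

Lemma talg_scaleAr (c : K) (x y : A ⊗ B) : c *: (x * y) = x * (c *: y).
Proof.
elim/tensor_ind: x => [a b|s t hs ht]; last by rewrite !mulrDl scalerDr hs ht.
by rewrite -![_ * _]/(talg_mul _ _) /talg_mul !tliftE linearZ.
Qed.

HB.instance Definition _ :=
  GRing.Lalgebra_isAlgebra.Build K (A ⊗ B) talg_scaleAr.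

End TensorAlgebra.

HB.mixin Record Lmodule_isCoalgebra (K : fieldType) C of GRing.Lmodule K C := {
  comul : {linear C -> C ⊗ C};
  counit : {linear C -> K^o};
  comulA : forall c,
    tassoc C C C (tmap comul idfun (comul c)) = tmap idfun comul (comul c);
  (* The codomains K ⊗ C and C ⊗ K are not identified with C. *)
  comul_counitl : forall c, tmap counit idfun (comul c) = (1 : K^o) ⊗ₜ c;
  comul_counitr : forall c, tmap idfun counit (comul c) = c ⊗ₜ (1 : K^o);
}.

#[short(type="coalgType")]
HB.structure Definition Coalgebra (K : fieldType) :=
  {C of GRing.Lmodule K C & Lmodule_isCoalgebra K C}.

HB.mixin Record Algebra_Coalgebra_isBialgebra (K : fieldType) H
    of GRing.Algebra K H & Coalgebra K H := {
  comul1 : comul (1 : H) = 1;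
  comulM : forall x y : H, comul (x * y) = comul x * comul y;
  counit1 : counit (1 : H) = 1;
  counitM : forall x y : H, counit (x * y) = counit x * counit y;
}.

#[short(type="bialgType")]
HB.structure Definition Bialgebra (K : fieldType) :=
  {H of GRing.Algebra K H & Coalgebra K H & Algebra_Coalgebra_isBialgebra K H}.

HB.mixin Record Bialgebra_isHopfAlgebra (K : fieldType) H of Bialgebra K H := {
  antipode : {linear H -> H};
  antipodel : forall h : H,
    tmul H (tmap antipode idfun (comul h)) = (counit h : K) *: 1;
  antipoder : forall h : H,
    tmul H (tmap idfun antipode (comul h)) = (counit h : K) *: 1;
}.

#[short(type="hopfAlgType")]
HB.structure Definition HopfAlgebra (K : fieldType) :=
  {H of Bialgebra K H & Bialgebra_isHopfAlgebra K H}.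

Definition cocommutative (K : fieldType) (C : coalgType K) : Prop :=
  forall c : C, tswap C C (comul c) = comul c.

HB.mixin Record Lmodule_isComodule (K : fieldType) (H : hopfAlgType K) P
    of GRing.Lmodule K P := {
  coact : {linear P -> P ⊗ H};
  coactA : forall p,
    tassoc P H H (tmap coact idfun (coact p)) = tmap idfun comul (coact p);
  coact_counit : forall p, tmap idfun counit (coact p) = p ⊗ₜ (1 : K^o);
}.

#[short(type="comodType")]
HB.structure Definition Comodule (K : fieldType) (H : hopfAlgType K) :=
  {P of GRing.Lmodule K P & Lmodule_isComodule K H P}.

HB.mixin Record Algebra_Comodule_isComodAlgebra
    (K : fieldType) (H : hopfAlgType K) P
    of GRing.Algebra K P & Comodule K H P := {
  coact1 : coact (1 : P) = 1 :> P ⊗ H;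
  coactM : forall x y : P, coact (x * y) = coact x * coact y :> P ⊗ H;
}.

#[short(type="comodAlgType")]
HB.structure Definition ComodAlgebra (K : fieldType) (H : hopfAlgType K) :=
  {P of GRing.Algebra K P & Comodule K H P & Algebra_Comodule_isComodAlgebra K H P}.

Section Factor.
Context (K : fieldType) (U X Y : lmodType K).
Context (j : {linear X -> Y}) (jI : injective j) (f : {linear U -> Y}).
Context (fj : forall u, exists x, j x = f u).

Definition factor_fun (u : U) : X := sval (cid (fj u)).

Lemma factor_funK u : j (factor_fun u) = f u.
Proof. exact: svalP (cid (fj u)). Qed.

Lemma factor_linear : linear factor_fun.
Proof. by move=> a x y; apply: jI; rewrite factor_funK !linearP !factor_funK. Qed.

HB.instance Definition _ :=
  GRing.isLinear.Build K U X *:%R factor_fun factor_linear.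

Definition factor : {linear U -> X} := factor_fun.

Lemma factorK u : j (factor u) = f u.
Proof. exact: factor_funK. Qed.

End Factor.

Section Subspace.
Context (K : fieldType) (V : lmodType K) (S : submodClosed V).

Definition subspace : Type := {v : V | v \in S}.

HB.instance Definition _ := SubChoice.on subspace.
HB.instance Definition _ := [SubChoice_isSubLmodule of subspace by <:].

Definition subval : {linear subspace -> V} := val.

End Subspace.

Record subcomodule (K : fieldType) (H : hopfAlgType K) (P : comodType H) := {
  subcomod_carrier :> submodClosed P;
  subcomod_coact : forall v : subspace subcomod_carrier,
    exists t : subspace subcomod_carrier ⊗ H,
      tmap (subval subcomod_carrier) idfun t = coact (subval _ v)
}.

Section Subcomodule.
Context (K : fieldType) (H : hopfAlgType K) (P : comodType H).
Context (V : subcomodule P).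

Definition subcomod : Type := subspace V.

HB.instance Definition _ := GRing.Lmodule.on subcomod.

Definition incl : {linear subcomod -> P} := subval V.

Lemma incl_inj : injective incl.
Proof. exact: val_inj. Qed.

Lemma incl_tmap_inj (W : lmodType K) :
  injective (tmap incl (idfun : {linear W -> W})).
Proof. by apply: tmap_inj => //; exact: incl_inj. Qed.

Definition sub_coact : {linear subcomod -> subcomod ⊗ H} :=
  factor (incl_tmap_inj (W := H)) (f := coact \o incl) (@subcomod_coact _ _ _ V).

Lemma sub_coactK v : tmap incl idfun (sub_coact v) = coact (incl v).
Proof. exact: factorK. Qed.

Lemma sub_coactA v : tassoc _ H H (tmap sub_coact idfun (sub_coact v)) =
  tmap idfun comul (sub_coact v).
Proof.
apply: (@incl_tmap_inj (H ⊗ H)).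
have nat1 (t : subcomod ⊗ H ⊗ H) : tmap incl idfun (tassoc _ H H t) =
    tassoc P H H (tmap (tmap incl idfun) idfun t).
  elim/tensor_ind: t => [t h|x y hx hy]; last by rewrite !linearD hx hy.
  elim/tensor_ind: t => [w g|x y hx hy].
    by rewrite tassocE !tmapE tassocE.
  by rewrite tensDl !linearD hx hy.
have nat2 (t : subcomod ⊗ H) :
    tmap incl idfun (tmap idfun comul t) = tmap idfun comul (tmap incl idfun t).
  elim/tensor_ind: t => [w g|x y hx hy]; first by rewrite !tmapE.
  by rewrite !linearD hx hy.
have nat3 (t : subcomod ⊗ H) :
    tmap (tmap incl idfun) idfun (tmap sub_coact idfun t) =
    tmap coact idfun (tmap incl idfun t).
  elim/tensor_ind: t => [w g|x y hx hy]; first by rewrite !tmapE /= sub_coactK.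
  by rewrite !linearD hx hy.
by rewrite nat1 nat2 nat3 sub_coactK coactA.
Qed.

Lemma sub_coact_counit v : tmap idfun counit (sub_coact v) = v ⊗ₜ (1 : K^o).
Proof.
apply: (@incl_tmap_inj K^o); rewrite tmapE -coact_counit -sub_coactK.
elim/tensor_ind: (sub_coact v) => [w g|x y hx hy]; first by rewrite !tmapE.
by rewrite !linearD hx hy.
Qed.

HB.instance Definition _ :=
  Lmodule_isComodule.Build K H subcomod sub_coactA sub_coact_counit.

End Subcomodule.

Coercion subcomod : subcomodule >-> Sortclass.

Definition colinear (K : fieldType) (H : hopfAlgType K) (P Q : comodType H)
    (f : {linear P -> Q}) : Prop :=
  forall p, coact (f p) = tmap f idfun (coact p).

Section Coinvariants.
Context (K : fieldType) (H : hopfAlgType K) (P : comodAlgType H).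

Definition coinvariant : pred P := fun p => coact p == p ⊗ₜ (1 : H).

Lemma coinvariantE p : (p \in coinvariant) = (coact p == p ⊗ₜ (1 : H)).
Proof. by []. Qed.

Lemma coinvariant_subalg : subalg_closed coinvariant.
Proof.
split=> [|a x y|x y]; rewrite !coinvariantE.
- by rewrite coact1.
- by move=> /eqP hx /eqP hy; rewrite linearP hx hy tensDl tensZl.
- by move=> /eqP hx /eqP hy; rewrite coactM hx hy tens_mul mulr1.
Qed.

HB.instance Definition _ :=
  GRing.isSubalgClosed.Build K P coinvariant
    (GRing.subalg_closed_semi coinvariant_subalg).

Definition coinv : Type := {p : P | p \in coinvariant}.

HB.instance Definition _ := SubChoice.on coinv.
HB.instance Definition _ := [SubChoice_isSubAlgebra of coinv by <:].

End Coinvariants.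

Section CoinvRestriction.
Context (K : fieldType) (H : hopfAlgType K) (P Q : comodAlgType H).
Context (f : {lrmorphism P -> Q}) (cf : colinear f).

Lemma coinv_res_subproof (p : coinv P) : f (val p) \in @coinvariant K H Q.
Proof.
have := valP p; rewrite !coinvariantE => /eqP hp.
by rewrite cf hp tmapE.
Qed.

(* The restriction of f to the coinvariant subalgebras. *)
Definition coinv_res (p : coinv P) : coinv Q :=
  exist _ (f (val p)) (coinv_res_subproof p).

Lemma coinv_res_linear : linear coinv_res.
Proof. by move=> a x y; apply: val_inj; rewrite /= !linearP. Qed.

Lemma coinv_res_monoid : monoid_morphism coinv_res.
Proof.
by split=> [|x y]; apply: val_inj; rewrite /= ?rmorph1 ?rmorphM.
Qed.

HB.instance Definition _ :=
  GRing.isLinear.Build K (coinv P) (coinv Q) *:%R coinv_res coinv_res_linear.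
HB.instance Definition _ :=
  GRing.isMonoidMorphism.Build (coinv P) (coinv Q) coinv_res coinv_res_monoid.

End CoinvRestriction.

Section Covering.
Context (K : fieldType) (A : algType K).

Definition idealD (X Y : set A) : set A := [set x + y | x in X & y in Y].

(* The lattice generated by G with respect to + and intersection. *)
Inductive ideal_lattice (G : set (set A)) : set (set A) :=
| IdealGen X : G X -> ideal_lattice G X
| IdealSum X Y :
    ideal_lattice G X -> ideal_lattice G Y -> ideal_lattice G (idealD X Y)
| IdealCap X Y :
    ideal_lattice G X -> ideal_lattice G Y -> ideal_lattice G (X `&` Y).

Definition distributive_ideals (L : set (set A)) : Prop :=
  forall X Y Z, L X -> L Y -> L Z ->
    X `&` idealD Y Z = idealD (X `&` Y) (X `&` Z).

Definition ideal_ker (B : algType K) (f : {lrmorphism A -> B}) : set A :=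
  [set a | f a = 0].

Definition covering (I : finType) (B : I -> algType K)
    (f : forall i, {lrmorphism A -> B i}) : Prop :=
  [/\ forall i b, exists a, f i a = b,
      \bigcap_i ideal_ker (f i) = [set 0] &
      distributive_ideals (ideal_lattice [set ideal_ker (f i) | i in setT])].

End Covering.

Section StrongConnection.
Context (K : fieldType) (H : hopfAlgType K) (P : comodAlgType H).

(* The last two conditions are, in Sweedler notation,
     l(h1)<1> ⊗ l(h1)<2> ⊗ h2 = l(h)<1> ⊗ l(h)<2>_(0) ⊗ l(h)<2>_(1)
     S(h1) ⊗ l(h2)<1> ⊗ l(h2)<2> = l(h)<1>_(1) ⊗ l(h)<1>_(0) ⊗ l(h)<2>.
   Bijectivity of the antipode is not part of the definition: it is automatic
   for a cocommutative H. *)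
Definition strong_connection (l : {linear H -> P ⊗ P}) : Prop :=
  [/\ l 1 = 1 ⊗ₜ 1,
      forall h, tmul P (l h) = (counit h : K)%:A,
      forall h, tassoc P P H (tmap l idfun (comul h)) =
        tmap idfun coact (l h) &
      forall h, tmap antipode l (comul h) =
        tassoc H P P (tmap (tswap P H \o coact) idfun (l h))].

Definition principal : Prop :=
  exists l : {linear H -> P ⊗ P}, strong_connection l.

End StrongConnection.

Definition piecewise_principal (K : fieldType) (H : hopfAlgType K)
    (P : comodAlgType H) (I : finType) (P_ : I -> comodAlgType H)
    (pi : forall i, {lrmorphism P -> P_ i}) (cpi : forall i, colinear (pi i)) :
    Prop :=
  [/\ forall i p, exists q, pi i q = p,
      covering (fun i => coinv_res (cpi i)) &
      forall i, principal (P_ i)].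

Section Convolution.
Context (K : fieldType) (C : coalgType K) (A : algType K).

(* The convolution product c |-> f(c1) g(c2). *)
Definition conv (f g : {linear C -> A}) : {linear C -> A} :=
  tmul A \o tmap f g \o comul.

Definition conv_unit_fun (c : C) : A := (counit c : K)%:A.

Lemma conv_unit_linear : linear conv_unit_fun.
Proof.
by move=> a x y; rewrite /conv_unit_fun linearP scalerDl scalerA.
Qed.

HB.instance Definition _ :=
  GRing.isLinear.Build K C A *:%R conv_unit_fun conv_unit_linear.

Definition conv_unit : {linear C -> A} := conv_unit_fun.

End Convolution.

Section Gluing.
Context (K : fieldType) (H : hopfAlgType K) (P : comodAlgType H) (n : nat).
Context (P_ : 'I_n.+1 -> comodAlgType H).
Context (l_ : forall i, {linear H -> P_ i ⊗ P_ i}).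
Context (V : forall i, subcomodule (P_ i)).
Context (lV : forall i h, exists t : V i ⊗ V i,
  tmap (incl (V i)) (incl (V i)) t = l_ i h).
Context (alpha : forall i, {linear V i -> P}).

(* h |-> alpha_i(l_i(h)<1>) ⊗ alpha_i(l_i(h)<2>). The map alpha_i is only
   defined on V_i, so l_i is first corestricted to V_i ⊗ V_i; the corestriction
   is unique because V_i ⊗ V_i -> P_i ⊗ P_i is injective. *)
Definition lift_connection i : {linear H -> P ⊗ P} :=
  tmap (alpha i) (alpha i) \o
    factor (tmap_inj (@incl_inj _ _ _ (V i)) (@incl_inj _ _ _ (V i))) (lV i).

Definition theta i : {linear H -> P} :=
  conv_unit H P \- (tmul P \o lift_connection i).

(* T_k(h) = theta_k(h1) theta_{k+1}(h2) ... theta_n(h_{n-k+1}), and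
   T_{n+1}(h) = counit(h) is the empty convolution product. *)
Definition theta_tail (k : nat) : {linear H -> P} :=
  \big[@conv K H P / conv_unit H P]_(j < n.+1 | (k <= j)%N) theta j.

(* \sum_i alpha_i(l_i(h1)<1>) ⊗ alpha_i(l_i(h1)<2>) T_{i+1}(h2). *)
Definition glue_fun (h : H) : P ⊗ P :=
  \sum_(i < n.+1) tmap idfun (tmul P) (tassoc P P P
     (tmap (lift_connection i) (theta_tail i.+1) (comul h))).

Lemma glue_linear : linear glue_fun.
Proof.
move=> a x y; rewrite /glue_fun scaler_sumr -big_split /=.
by apply: eq_bigr => i _; rewrite !linearP.
Qed.

HB.instance Definition _ :=
  GRing.isLinear.Build K H (P ⊗ P) *:%R glue_fun glue_linear.

Definition glue : {linear H -> P ⊗ P} := glue_fun.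

End Gluing.

(* Main.v *)
Require Import Defs.
From HB Require Import structures.
From mathcomp Require Import all_boot all_algebra.
From mathcomp Require Import boolp classical_sets.

Import GRing.Theory.
Local Open Scope ring_scope.

(** Write L_i for the lifted connection alpha_i(l_i<1>) ⊗ alpha_i(l_i<2>), so
    that theta_i = epsilon - m(L_i), with m the multiplication of P, and
    T_i = theta_i * T_{i+1} for the convolution product. The glued map is the
    sum over i of L_i.T_{i+1}, where L.T (conv_act) multiplies the second leg
    of L(h1) on the right by T(h2).

    Multiplicativity, m(l(h)) = epsilon(h): as m(L.T) = m(L) * T, the i-th
    term becomes (epsilon - theta_i) * T_{i+1} = T_{i+1} - T_i, and the sum
    telescopes to epsilon - T_0. That T_0 vanishes is where the covering
    enters. Each theta_i(h) is killed by pi_i, because alpha_i splits pi_i and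
    l_i is a strong connection; the convolution product T_0(h) has a factor in
    every ker pi_i, so it lies in all of them. But the covering hypothesis only
    says that these kernels meet trivially inside the coinvariants, so theta_i
    has to be shown coinvariant (coinvariant_tmul): by the two colinearity
    conditions the coaction sends m(L_i(h)) to m(L_i(h2)) ⊗ S(h1) h3, and
    cocommutativity lets h3 be moved next to S(h1), where the antipode axiom
    removes both.

    Colinearity: on the right, T_{i+1} being coinvariant, the coaction on
    L_i(h1)<2> T_{i+1}(h2) yields L_i(h1)<2> T_{i+1}(h3) ⊗ h2; cocommutativity
    exchanges h2 and h3 as required (right_colinear_conv_act). On the
    left, the first leg is not affected by T_{i+1}, and coassociativity is
    enough (left_colinear_conv_act). That L_i itself is colinear on both sides
    is inherited from l_i, first by corestriction along the injective
    inclusion of V_i and then by composition with the colinear alpha_i.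

    Unitality: L_i(1) = 1 ⊗ 1, hence theta_i(1) = 0, so T_{i+1}(1) = 0 except
    for i = n, and only the last term survives at 1. *)

(** * Natural maps between iterated tensor products *)

(* These maps are canonical linear functions, so that simplification would
   otherwise unfold them to tlift wherever they are applied. *)
Opaque tmap tswap tassoc tmul.

Lemma comp_linE {K : fieldType} {X Y Z : lmodType K}
  (f : {linear Y -> Z}) (g : {linear X -> Y}) x :
  (f \o g : {linear X -> Z}) x = f (g x).
Proof. by []. Qed.

Lemma id_linE {K : fieldType} {X : lmodType K} x :
  (idfun : {linear X -> X}) x = x.
Proof. by []. Qed.

Definition linE := (@comp_linE, @id_linE).

(* Reduces a goal that is additive in the tensor t to pure tensors a ⊗ₜ b. *)
Ltac pure_tensor t a b :=
  elim/tensor_ind: t => [a b|];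
  [|by let H1 := fresh in let H2 := fresh in intros ? ? H1 H2;
     rewrite ?(mulrDl, mulrDr, tensDl, tensDr, linearD) H1 H2].

HB.lock Definition tassocV {K : fieldType} (X Y Z : lmodType K) :
    {linear X ⊗ (Y ⊗ Z) -> X ⊗ Y ⊗ Z} :=
  tswap Z (X ⊗ Y) \o tassoc Z X Y \o tswap Y (Z ⊗ X) \o tassoc Y Z X
    \o tswap X (Y ⊗ Z).

Lemma tassocVE {K : fieldType} {X Y Z : lmodType K} (x : X) (y : Y) (z : Z) :
  tassocV X Y Z (x ⊗ₜ (y ⊗ₜ z)) = x ⊗ₜ y ⊗ₜ z.
Proof. by rewrite tassocV.unlock !linE tswapE tassocE tswapE tassocE tswapE. Qed.

Lemma tassocK {K : fieldType} {X Y Z : lmodType K} :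
  cancel (tassoc X Y Z) (tassocV X Y Z).
Proof.
by move=> t; pure_tensor t w z; pure_tensor w x y; rewrite tassocE tassocVE.
Qed.

HB.lock Definition tswap23 {K : fieldType} (X Y Z : lmodType K) :
    {linear X ⊗ Y ⊗ Z -> X ⊗ Z ⊗ Y} :=
  tassocV X Z Y \o tmap idfun (tswap Y Z) \o tassoc X Y Z.

Lemma tswap23E {K : fieldType} {X Y Z : lmodType K} (x : X) (y : Y) (z : Z) :
  tswap23 X Y Z (x ⊗ₜ y ⊗ₜ z) = x ⊗ₜ z ⊗ₜ y.
Proof. by rewrite tswap23.unlock !linE tassocE tmapE tswapE tassocVE. Qed.

Lemma tmap_tmap {K : fieldType} {X X' X'' Y Y' Y'' : lmodType K}
    (f : {linear X -> X'}) (f' : {linear X' -> X''})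
    (g : {linear Y -> Y'}) (g' : {linear Y' -> Y''}) t :
  tmap f' g' (tmap f g t) = tmap (f' \o f) (g' \o g) t.
Proof. by pure_tensor t x y; rewrite !tmapE. Qed.

Lemma eq_tmap {K : fieldType} {X X' Y Y' : lmodType K}
    {f f' : {linear X -> X'}} {g g' : {linear Y -> Y'}} t :
  f =1 f' -> g =1 g' -> tmap f g t = tmap f' g' t.
Proof. by move=> ff gg; pure_tensor t x y; rewrite !tmapE ff gg. Qed.

Lemma tens0l {K : fieldType} {X Y : lmodType K} (y : Y) : (0 : X) ⊗ₜ y = 0.
Proof. by rewrite -(scale0r (0 : X)) tensZl scale0r. Qed.

Lemma tens0r {K : fieldType} {X Y : lmodType K} (x : X) : x ⊗ₜ (0 : Y) = 0.
Proof. by rewrite -(scale0r (0 : Y)) tensZr scale0r. Qed.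

Lemma tmap_suml {K : fieldType} {X X' Y Y' : lmodType K} {I : Type} {s : seq I}
    {f : {linear X -> X'}} {F : I -> {linear X -> X'}} {g : {linear Y -> Y'}} {t} :
  (forall x, f x = \sum_(i <- s) F i x) ->
  tmap f g t = \sum_(i <- s) tmap (F i) g t.
Proof.
move=> fE; elim/tensor_ind: t => [x y|t u ht hu].
  rewrite tmapE fE (big_morph (fun x' => x' ⊗ₜ g y) (id1 := 0) (op1 := +%R)).
  - by apply: eq_bigr => i _; rewrite tmapE.
  - by move=> v v'; exact: tensDl.
  - exact: tens0l.
by rewrite linearD ht hu -big_split; apply: eq_bigr => i _; rewrite linearD.
Qed.

Lemma tmap_sumr {K : fieldType} {X X' Y Y' : lmodType K} {I : Type} {s : seq I}
    {f : {linear X -> X'}} {g : {linear Y -> Y'}} {G : I -> {linear Y -> Y'}} {t} :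
  (forall y, g y = \sum_(i <- s) G i y) ->
  tmap f g t = \sum_(i <- s) tmap f (G i) t.
Proof.
move=> gE; elim/tensor_ind: t => [x y|t u ht hu].
  rewrite tmapE gE (big_morph (fun y' => f x ⊗ₜ y') (id1 := 0) (op1 := +%R)).
  - by apply: eq_bigr => i _; rewrite tmapE.
  - by move=> w w'; exact: tensDr.
  - exact: tens0r.
by rewrite linearD ht hu -big_split; apply: eq_bigr => i _; rewrite linearD.
Qed.

(** A functional equal to 1 at y' contracts the second factor: it sends x' ⊗ₜ y'
    to x', and the image of tmap f g into the image of f. *)
Lemma tmap_pure_image {K : fieldType} {X X' Y Y' : lmodType K}
    {f : {linear X -> X'}} {g : {linear Y -> Y'}} {t x' y'} :
  tmap f g t = x' ⊗ₜ y' -> y' != 0 -> exists x, f x = x'.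
Proof.
move=> ft /functional_neq0[phi phi1].
have bf : bilinear_fun (fun (u : X') (w : Y') => (phi w : K) *: u).
  split=> a *; first by rewrite scalerDr !scalerA mulrC.
  by rewrite linearP scalerDl scalerA.
have <- : tlift bf (tmap f g t) = x' by rewrite ft tliftE phi1 scale1r.
elim/tensor_ind: t {ft} => [x y|t u [x xE] [y yE]].
  by exists ((phi (g y) : K) *: x); rewrite tmapE tliftE linearZ.
by exists (x + y); rewrite !linearD xE yE.
Qed.

(** * Sweedler calculus *)

Section Sweedler.
Context {K : fieldType} {H : hopfAlgType K}.

Definition comul3 (h : H) : H ⊗ H ⊗ H := tmap comul idfun (comul h).

(** By coassociativity the last two factors of h1 ⊗ h2 ⊗ h3 are the legs of a
    single comultiplication, and that one is symmetric. *)
Lemma comul3_swap23 (h : H) :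
  cocommutative H -> tswap23 H H H (comul3 h) = comul3 h.
Proof.
move=> coco; rewrite tswap23.unlock !linE comulA tmap_tmap -[RHS]tassocK comulA.
by congr (tassocV H H H _); apply: eq_tmap => // x; exact: coco.
Qed.

(** Sweedler's rule epsilon(h1) f(h2) = f(h), with F standing for any way of
    writing the left-hand side as a linear function of h1 ⊗ h2; it spares the
    identification of K ⊗ H with H. *)
Lemma counit_suml {Z : lmodType K} (f : H -> Z)
    (F : {linear H ⊗ H -> Z}) h : linear f ->
  (forall a b, F (a ⊗ₜ b) = (counit a : K) *: f b) -> F (comul h) = f h.
Proof.
move=> lf FE.
have bG : bilinear_fun (fun (c : K^o) (x : H) => (c : K) *: f x).
  split=> a *; first by rewrite scalerDl -scalerA.
  by rewrite lf scalerDr !scalerA mulrC.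
have -> : F (comul h) = tlift bG (tmap counit idfun (comul h)).
  by pure_tensor (comul h) a b; rewrite FE tmapE tliftE.
by rewrite comul_counitl tliftE scale1r.
Qed.

End Sweedler.

(** * The colinearity conditions of a strong connection *)

Section BicolinearForms.
Context {K : fieldType} {H : hopfAlgType K}.

(** Together with left_colinear, this isolates the part of a strong connection
    that makes sense for a comodule without product, such as V_i. *)
Definition right_colinear {X : comodType H} (L : {linear H -> X ⊗ X}) : Prop :=
  forall h, tassoc X X H (tmap L idfun (comul h)) = tmap idfun coact (L h).

Definition left_colinear {X : comodType H} (L : {linear H -> X ⊗ X}) : Prop :=
  forall h, tmap antipode L (comul h) =
    tassoc H X X (tmap (tswap X H \o coact) idfun (L h)).

Section Transport.
Context {X Y : comodType H} (f : {linear X -> Y}) (cf : colinear f).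

Lemma right_coact_tmap (w : X ⊗ X) :
  tmap idfun coact (tmap f f w) = tmap f (tmap f idfun) (tmap idfun coact w).
Proof. by pure_tensor w x y; rewrite !tmapE /= cf. Qed.

Lemma left_coact_tmap (w : X ⊗ X) :
  tassoc H Y Y (tmap (tswap Y H \o coact) idfun (tmap f f w)) =
  tmap idfun (tmap f f) (tassoc H X X (tmap (tswap X H \o coact) idfun w)).
Proof.
pure_tensor w x y; rewrite !tmapE /= cf; pure_tensor (coact x) z h.
by rewrite tmapE !tswapE !tassocE !tmapE.
Qed.

Lemma tassoc_tmap_comp (L : {linear H -> X ⊗ X}) (u : H ⊗ H) :
  tassoc Y Y H (tmap (tmap f f \o L) idfun u) =
  tmap f (tmap f idfun) (tassoc X X H (tmap L idfun u)).
Proof.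
pure_tensor u a b; rewrite !tmapE /=; pure_tensor (L a) x y.
by rewrite tassocE !tmapE tassocE.
Qed.

Lemma right_colinear_tmap (L : {linear H -> X ⊗ X}) :
  right_colinear L -> right_colinear (tmap f f \o L).
Proof. by move=> rL h; rewrite tassoc_tmap_comp rL /= right_coact_tmap. Qed.

Lemma left_colinear_tmap (L : {linear H -> X ⊗ X}) :
  left_colinear L -> left_colinear (tmap f f \o L).
Proof.
by move=> lL h; rewrite /= left_coact_tmap -lL tmap_tmap; apply: eq_tmap.
Qed.

Context (fI : injective f).

Lemma right_colinear_corestrict (L : {linear H -> X ⊗ X}) :
  right_colinear (tmap f f \o L) -> right_colinear L.
Proof.
move=> rL h; apply: (tmap_inj (V := X) (W := X ⊗ H) (f := f) (g := tmap f idfun)).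
- exact: fI.
- by apply: tmap_inj.
- by rewrite -right_coact_tmap -tassoc_tmap_comp rL.
Qed.

Lemma left_colinear_corestrict (L : {linear H -> X ⊗ X}) :
  left_colinear (tmap f f \o L) -> left_colinear L.
Proof.
move=> lL h.
apply: (tmap_inj (V := H) (W := X ⊗ X) (f := idfun) (g := tmap f f)).
- by [].
- by apply: tmap_inj.
- by rewrite -left_coact_tmap [LHS]tmap_tmap -[RHS]lL; apply: eq_tmap.
Qed.

End Transport.
End BicolinearForms.

(** * Convolution products and their action on maps into P ⊗ P *)

HB.lock Definition mulr_tensor {K : fieldType} (A : algType K) :
    {linear A ⊗ A ⊗ A -> A ⊗ A} :=
  tmap idfun (tmul A) \o tassoc A A A.

Lemma mulr_tensorE {K : fieldType} {A : algType K} (p q t : A) :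
  mulr_tensor A (p ⊗ₜ q ⊗ₜ t) = p ⊗ₜ (q * t).
Proof. by rewrite mulr_tensor.unlock !linE tassocE tmapE tmulE. Qed.

Section ConvolutionAction.
Context {K : fieldType} {H : hopfAlgType K} {P : comodAlgType H}.
Implicit Types (L : {linear H -> P ⊗ P}) (f g T : {linear H -> P}).

Definition conv_act L T : {linear H -> P ⊗ P} :=
  mulr_tensor P \o tmap L T \o comul.

Lemma tmul_conv_act L T h :
  tmul P (conv_act L T h) = conv (tmul P \o L) T h.
Proof.
rewrite /conv_act /conv !linE; pure_tensor (comul h) a b.
rewrite !tmapE linE; pure_tensor (L a) p q.
by rewrite mulr_tensorE !tmulE mulrA.
Qed.

Definition coinvariant_valued T := forall h, T h \in @coinvariant K H P.

Lemma coinvariant_conv f g :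
  coinvariant_valued f -> coinvariant_valued g -> coinvariant_valued (conv f g).
Proof.
move=> cf cg h; rewrite /conv /=; elim/tensor_ind: (comul h) => [a b|x y hx hy].
  by rewrite tmapE tmulE rpredM.
by rewrite !linearD rpredD.
Qed.

Lemma coinvariant_conv_unit : coinvariant_valued (conv_unit H P).
Proof. by move=> h; rewrite rpredZ ?rpred1. Qed.

(** In Sweedler notation, the coaction of m(L(h)) is m(L(h2)) ⊗ S(h1) h3, by
    left and right colinearity. For cocommutative H the tensor h1 ⊗ h2 ⊗ h3 may
    be replaced by h1 ⊗ h3 ⊗ h2, and S(h1) h2 collapses to the counit. *)
Lemma coinvariant_tmul L : cocommutative H -> right_colinear L ->
  left_colinear L -> coinvariant_valued (tmul P \o L).
Proof.
move=> coco rL lL h; rewrite coinvariantE; apply/eqP.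
(* N is s ⊗ (p ⊗ q) ⊗ g |-> pq ⊗ sg. *)
pose N : {linear H ⊗ (P ⊗ P) ⊗ H -> P ⊗ H} :=
  tswap H P \o tmap (tmul H) (tmul P) \o tswap23 H (P ⊗ P) H.
(* The coaction of a product is computed one leg at a time, the right one
   first, so that rL and then lL apply. *)
have coactE (w : P ⊗ P) : coact (tmul P w) = N (tmap
    (tassoc H P P \o tmap (tswap P H \o coact) idfun) idfun
    (tassocV P P H (tmap idfun coact w))).
  pure_tensor w p q; rewrite tmulE coactM tmapE /=; pure_tensor (coact q) y g.
  rewrite tassocVE !tmapE /= !tmapE /=; pure_tensor (coact p) x s.
  by rewrite tswapE tassocE tswap23E tmapE !tmulE tswapE tens_mul.
rewrite /= coactE -rL tassocK tmap_tmap.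
have -> : tmap (tassoc H P P \o tmap (tswap P H \o coact) idfun \o L)
    (idfun \o idfun) (comul h) =
    tmap (tmap antipode L) idfun (comul3 h).
  by rewrite /comul3 tmap_tmap; apply: eq_tmap => // x; rewrite /= -lL.
have -> : N (tmap (tmap antipode L) idfun (comul3 h)) = tswap H P
    (tmap (tmul H \o tmap antipode idfun) (tmul P \o L)
      (tswap23 H H H (comul3 h))).
  pure_tensor (comul3 h) v c; pure_tensor v a b.
  by rewrite !tmapE /N /= !tswap23E !tmapE /= tmapE.
rewrite comul3_swap23 // /comul3 tmap_tmap.
apply: (@counit_suml _ _ _ (fun b => tmul P (L b) ⊗ₜ (1 : H)) (tswap H P \o
  tmap (tmul H \o tmap antipode idfun \o comul) (tmul P \o L \o idfun))).
  by move=> a x y; rewrite !linearP tensDl tensZl.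
by move=> a b; rewrite /= tmapE tswapE /= antipodel tensZr.
Qed.

(** The coaction on the second leg of L(h1) T(h2) gives
    L(h1)<1> ⊗ L(h1)<2> T(h3) ⊗ h2, whereas right colinearity asks for T(h2)
    followed by h3; these agree for cocommutative H. *)
Lemma right_colinear_conv_act L T : cocommutative H -> right_colinear L ->
  coinvariant_valued T -> right_colinear (conv_act L T).
Proof.
move=> coco rL cT h; rewrite /conv_act !linE.
have -> : tmap idfun coact (mulr_tensor P (tmap L T (comul h))) =
    tassoc P P H (tmap (mulr_tensor P) idfun (tswap23 (P ⊗ P) H P
      (tmap (tmap L idfun) T (comul3 h)))).
  rewrite /comul3 tmap_tmap; pure_tensor (comul h) a b; rewrite !tmapE /=.
  (* Right colinearity trades the comultiplication of a for the coaction on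
     L a, leaving an identity that is additive in L a. *)
  rewrite -[tmap L idfun (comul a)]tassocK rL; pure_tensor (L a) p q.
  have /eqP cTb := cT b.
  rewrite mulr_tensorE !tmapE coactM cTb /=; pure_tensor (coact q) q' g.
  by rewrite tens_mul mulr1 tassocVE tswap23E tmapE mulr_tensorE tassocE.
have -> : tswap23 (P ⊗ P) H P (tmap (tmap L idfun) T (comul3 h)) =
    tmap (tmap L T) idfun (tswap23 H H H (comul3 h)).
  pure_tensor (comul3 h) v c; pure_tensor v a b.
  by rewrite !(tmapE, tswap23E).
rewrite comul3_swap23 // /comul3 !tmap_tmap; congr (tassoc P P H _).
Qed.

Lemma left_colinear_conv_act L T : left_colinear L -> left_colinear (conv_act L T).
Proof.
move=> lL h; rewrite /conv_act !linE.
have -> : tassoc H P P (tmap (tswap P H \o coact) idfun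
      (mulr_tensor P (tmap L T (comul h)))) =
    tmap idfun (mulr_tensor P) (tassoc H (P ⊗ P) P
      (tmap (tmap antipode L) T (comul3 h))).
  rewrite /comul3 tmap_tmap; pure_tensor (comul h) a b; rewrite !tmapE !linE lL.
  pure_tensor (L a) p q; rewrite mulr_tensorE !tmapE !linE.
  pure_tensor (coact p) x g.
  by rewrite !tswapE !tassocE !tmapE mulr_tensorE.
have -> : tassoc H (P ⊗ P) P (tmap (tmap antipode L) T (comul3 h)) =
    tmap antipode (tmap L T) (tassoc H H H (comul3 h)).
  pure_tensor (comul3 h) v c; pure_tensor v a b.
  by rewrite !(tmapE, tassocE).
rewrite comulA !tmap_tmap; exact: eq_tmap.
Qed.

Lemma conv_act1 L T : L 1 = 1 ⊗ₜ 1 -> conv_act L T 1 = 1 ⊗ₜ T 1.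
Proof.
by move=> L1; rewrite /conv_act !linE comul1 tens_one tmapE L1 mulr_tensorE mul1r.
Qed.

Lemma conv1 f g : conv f g 1 = f 1 * g 1.
Proof. by rewrite /conv !linE comul1 tens_one tmapE tmulE. Qed.

Lemma conv_unit_l T h : conv (conv_unit H P) T h = T h.
Proof.
rewrite /conv !linE; apply: (@counit_suml _ _ _ T
  (tmul P \o tmap (conv_unit H P) T)) => [|a b]; first exact: linearP.
by rewrite linE tmapE tmulE -scalerAl mul1r.
Qed.

Lemma conv_subl f f' g h : conv (f \- f') g h = conv f g h - conv f' g h.
Proof.
rewrite /conv !linE; elim/tensor_ind: (comul h) => [a b|x y hx hy].
  by rewrite !tmapE !tmulE mulrBl.
by rewrite !linearD hx hy addrACA.
Qed.

Section Kernel.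
Context {B : algType K} (r : {lrmorphism P -> B}).

(** The kernel of r is a two-sided ideal, so one factor inside it suffices. *)
Lemma conv_ker f g : (forall h, r (f h) = 0) \/ (forall h, r (g h) = 0) ->
  forall h, r (conv f g h) = 0.
Proof.
move=> fg0 h; rewrite /conv !linE; elim/tensor_ind: (comul h) => [a b|x y hx hy].
  rewrite tmapE tmulE rmorphM; case: fg0 => r0.
    by rewrite [X in X * _]r0 mul0r.
  by rewrite [X in _ * X]r0 mulr0.
have rD u v : r (u + v) = r u + r v by exact: linearD.
by rewrite (linearD (tmap f g)) (linearD (tmul P)) rD hx hy addr0.
Qed.

End Kernel.
End ConvolutionAction.

(** The operation is arbitrary, without unit or associativity law: the index
    list itself starts with i once the smaller indices are filtered out. *)
Lemma big_ord_geq_cons (R : Type) (op : R -> R -> R) (x : R) (n : nat)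
    (F : 'I_n -> R) (i : 'I_n) :
  \big[op/x]_(j < n | (i <= j)%N) F j =
  op (F i) (\big[op/x]_(j < n | (i < j)%N) F j).
Proof.
rewrite -[LHS]big_filter -[in RHS]big_filter.
suff -> : [seq j : 'I_n <- index_enum 'I_n | (i <= j)%N] =
    i :: [seq j : 'I_n <- index_enum 'I_n | (i < j)%N] by rewrite big_cons.
apply: (inj_map val_inj); rewrite /= /index_enum -enumT.
have filterE (p : pred nat) : map val [seq j <- enum 'I_n | p (val j)] =
    [seq j <- iota 0 n | p j] by rewrite -val_enum_ord filter_map.
rewrite (filterE (fun j => i <= j)%N) (filterE (fun j => i < j)%N).
have -> : iota 0 n = iota 0 i ++ (i : nat) :: iota i.+1 (n - i.+1).
  by rewrite -[in LHS](subnKC (ltn_ord i)) addSnnS iotaD.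
have none (p : pred nat) : (forall j, p j -> i <= j)%N ->
    [seq j <- iota 0 i | p j] = [::].
  move=> ple; rewrite -(filter_pred0 (iota 0 i)); apply: eq_in_filter => j.
  rewrite mem_iota /= add0n => ji; apply/negbTE/negP => /ple.
  by rewrite leqNgt ji.
rewrite !filter_cat !none //=; last by move=> j /ltnW.
rewrite leqnn ltnn; congr cons; apply: eq_in_filter => j.
by rewrite mem_iota => /andP[ij _]; rewrite ij ltnW.
Qed.

(** * The glued connection *)

Section Gluing.
Context {K : fieldType} {H : hopfAlgType K} {P : comodAlgType H} {n : nat}.
Context (P_ : 'I_n.+1 -> comodAlgType H).
Context (pi : forall i, {lrmorphism P -> P_ i}).
Context (cpi : forall i, colinear (pi i)).
Context (l_ : forall i, {linear H -> P_ i ⊗ P_ i}).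
Context (V : forall i, subcomodule (P_ i)).
Context (lV : forall i h, exists t : V i ⊗ V i,
  tmap (incl (V i)) (incl (V i)) t = l_ i h).
Context (alpha : forall i, {linear V i -> P}).
Context (lstrong : forall i, strong_connection (l_ i)).
Context (alpha1 : forall i (v : V i), incl (V i) v = 1 -> alpha i v = 1).
Context (calpha : forall i, colinear (alpha i)).
Context (alphaK : forall i (v : V i), pi i (alpha i v) = incl (V i) v).

Let L := lift_connection lV alpha.
Let T := theta_tail lV alpha.

Let lV_corestr i : {linear H -> V i ⊗ V i} :=
  factor (tmap_inj (@incl_inj _ _ _ (V i)) (@incl_inj _ _ _ (V i))) (lV i).

Let lV_corestrK i h : tmap (incl (V i)) (incl (V i)) (lV_corestr i h) = l_ i h.
Proof. exact: factorK. Qed.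

Lemma incl_colinear i : colinear (incl (V i)).
Proof. by move=> v; rewrite -sub_coactK. Qed.

(** The tensor 1 ⊗ 1 = l_i(1) comes from V_i ⊗ V_i; this is what gives unitality
    of alpha_i a content. *)
Lemma one_in_subcomod i : exists v : V i, incl (V i) v = 1.
Proof.
have [l1 _ _ _] := lstrong i.
exact: (tmap_pure_image (etrans (lV_corestrK i 1) l1) (oner_neq0 _)).
Qed.

Lemma lift_connection1 i : L i 1 = 1 ⊗ₜ 1.
Proof.
have [v v1] := one_in_subcomod i; have [l1 _ _ _] := lstrong i.
rewrite /L /lift_connection linE -/(lV_corestr i).
have -> : lV_corestr i 1 = v ⊗ₜ v.
  apply: (tmap_inj (@incl_inj _ _ _ (V i)) (@incl_inj _ _ _ (V i))).
  by rewrite lV_corestrK l1 tmapE v1.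
by rewrite tmapE alpha1.
Qed.

Lemma right_colinear_lift i : right_colinear (L i).
Proof.
have [_ _ lr _] := lstrong i.
apply: (right_colinear_tmap (alpha i) (calpha i) (lV_corestr i)).
apply: (right_colinear_corestrict (incl (V i)) (incl_colinear i) (@incl_inj _ _ _ _)) => h.
rewrite linE lV_corestrK -lr; congr (tassoc _ _ _ _); apply: eq_tmap => // x.
exact: lV_corestrK.
Qed.

Lemma left_colinear_lift i : left_colinear (L i).
Proof.
have [_ _ _ ll] := lstrong i.
apply: (left_colinear_tmap (alpha i) (calpha i) (lV_corestr i)).
apply: (left_colinear_corestrict (incl (V i)) (incl_colinear i) (@incl_inj _ _ _ _)) => h.
rewrite linE lV_corestrK -ll; apply: eq_tmap => // x.
exact: lV_corestrK.
Qed.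

Lemma pi_theta i h : pi i (theta lV alpha i h) = 0.
Proof.
have [_ lm _ _] := lstrong i.
have -> : theta lV alpha i h = (counit h : K)%:A - tmul P (L i h) by [].
have tmul_lift w : (pi i : {linear P -> P_ i}) (tmul P (tmap (alpha i) (alpha i) w)) =
    tmul (P_ i) (tmap (incl (V i)) (incl (V i)) w).
  by pure_tensor w v v'; rewrite !tmapE !tmulE -!alphaK; exact: rmorphM.
rewrite linearB linearZ rmorph1 /L /lift_connection linE tmul_lift -/(lV_corestr i).
by rewrite lV_corestrK lm subrr.
Qed.

Context (coco : cocommutative H).

(** Coinvariance lets the covering of the coinvariants, which says nothing about
    the rest of P, detect that T_0 vanishes. *)
Lemma coinvariant_theta i : coinvariant_valued (theta lV alpha i).
Proof.
move=> h; apply: rpredB; first exact: coinvariant_conv_unit.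
exact: coinvariant_tmul (right_colinear_lift i) (left_colinear_lift i) h.
Qed.

Lemma coinvariant_theta_tail k : coinvariant_valued (T k).
Proof.
apply: (big_ind (@coinvariant_valued K H P)).
- exact: coinvariant_conv_unit.
- exact: coinvariant_conv.
- by move=> i _; exact: coinvariant_theta.
Qed.

Lemma theta_tailS (i : 'I_n.+1) : T i = conv (theta lV alpha i) (T i.+1).
Proof. exact: big_ord_geq_cons. Qed.

Lemma theta_tail_last h : T n.+1 h = (counit h : K)%:A.
Proof.
rewrite /T /theta_tail big_hasC // -all_predC; apply/allP => i _ /=.
by rewrite -ltnNge ltn_ord.
Qed.

Lemma pi_theta_tail i h : pi i (T 0 h) = 0.
Proof.
rewrite /T /theta_tail; have := mem_index_enum i.
elim: (index_enum _) h => [//|j r IH] h; rewrite inE big_cons /=.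
move=> /orP ij; apply: conv_ker.
case: ij => [/eqP <-|ir]; [by left; exact: pi_theta|right=> h'; exact: IH].
Qed.

(** Each theta_i contributes a factor in ker pi_i, so T_0(h) is a coinvariant
    lying in every kernel, and a covering has no nonzero such element. *)
Lemma theta_tail0 h : covering (fun i => coinv_res (cpi i)) -> T 0 h = 0.
Proof.
case=> _ kerI _.
pose t : coinv P :=
  exist (fun p => p \in @coinvariant K H P) _ (coinvariant_theta_tail 0 h).
have : (\bigcap_i ideal_ker (coinv_res (cpi i)))%classic t.
  by move=> i _; apply: val_inj; exact: pi_theta_tail.
by rewrite kerI => /(congr1 val).
Qed.

Lemma glueE h : glue lV alpha h = \sum_(i < n.+1) conv_act (L i) (T i.+1) h.
Proof.
by apply: eq_bigr => i _; rewrite /conv_act !linE mulr_tensor.unlock.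
Qed.

(** Since m(L_i) = epsilon - theta_i, the i-th term is
    (epsilon - theta_i) * T_{i+1}; the differences telescope over i. *)
Lemma tmul_conv_act_lift i h :
  tmul P (conv_act (L i) (T i.+1) h) = T i.+1 h - T i h.
Proof.
rewrite tmul_conv_act theta_tailS conv_subl conv_unit_l.
by rewrite opprB addrC subrK.
Qed.

Lemma tmul_glue h : covering (fun i => coinv_res (cpi i)) ->
  tmul P (glue lV alpha h) = (counit h : K)%:A.
Proof.
move=> cov; rewrite glueE linear_sum.
under eq_bigr => i _ do rewrite tmul_conv_act_lift.
rewrite -(big_mkord xpredT (fun i => T i.+1 h - T i h)) telescope_sumr //.
by rewrite theta_tail0 // subr0 theta_tail_last.
Qed.

Lemma theta1 i : theta lV alpha i 1 = 0.
Proof.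
have -> : theta lV alpha i 1 = (counit (1 : H) : K)%:A - tmul P (L i 1) by [].
by rewrite counit1 scale1r lift_connection1 tmulE mulr1 subrr.
Qed.

(** For i < n the tail T_{i+1} starts with theta_{i+1}, which vanishes at 1; only
    the term i = n, whose tail is the counit, remains. *)
Lemma glue1 : glue lV alpha 1 = 1 ⊗ₜ 1.
Proof.
rewrite glueE big_ord_recr big1 => [|i _].
  rewrite conv_act1; last exact: lift_connection1.
  by rewrite theta_tail_last counit1 scale1r; exact: add0r.
rewrite conv_act1; last exact: lift_connection1.
(* The successor of i < n is an index of the family, so T_{i+1} has a factor. *)
rewrite -[_.+1]/(lift ord0 i : nat).
by rewrite theta_tailS conv1 theta1 mul0r tens0r.
Qed.

Lemma right_colinear_glue : right_colinear (glue lV alpha).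
Proof.
move=> h; rewrite (tmap_suml glueE) glueE !linear_sum.
apply: eq_bigr => i _; apply: right_colinear_conv_act => //.
  exact: right_colinear_lift.
exact: coinvariant_theta_tail.
Qed.

Lemma left_colinear_glue : left_colinear (glue lV alpha).
Proof.
move=> h; rewrite (tmap_sumr glueE) glueE.
rewrite (linear_sum (tmap (tswap P H \o coact) idfun)) (linear_sum (tassoc H P P)).
by apply: eq_bigr => i _; apply: left_colinear_conv_act; exact: left_colinear_lift.
Qed.

End Gluing.

Theorem theorem1 (K : fieldType) (H : hopfAlgType K) (P : comodAlgType H)
    (n : nat) (P_ : 'I_n.+1 -> comodAlgType H)
    (pi : forall i : 'I_n.+1, {lrmorphism P -> P_ i})
    (pi_colinear : forall i : 'I_n.+1, colinear (pi i))
    (l_ : forall i : 'I_n.+1, {linear H -> P_ i ⊗ P_ i})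
    (V : forall i : 'I_n.+1, subcomodule (P_ i))
    (l_in_V : forall (i : 'I_n.+1) (h : H),
      exists t : V i ⊗ V i, tmap (incl (V i)) (incl (V i)) t = l_ i h)
    (alpha : forall i : 'I_n.+1, {linear V i -> P}) :
  cocommutative H ->
  piecewise_principal pi_colinear ->
  (forall i : 'I_n.+1, strong_connection (l_ i)) ->
  (forall (i : 'I_n.+1) (v : V i), incl (V i) v = 1 -> alpha i v = 1) ->
  (forall i : 'I_n.+1, colinear (alpha i)) ->
  (forall (i : 'I_n.+1) (v : V i), pi i (alpha i v) = incl (V i) v) ->
  strong_connection (glue l_in_V alpha).
Proof.
move=> coco [_ cov _] lstrong alpha1 calpha alphaK; split.
- exact: glue1.
- by move=> h; apply: (tmul_glue P_ pi pi_colinear).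
- exact: right_colinear_glue.
- exact: left_colinear_glue.
Qed.
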